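(* Let $k\ge 1$ be real. In the covering path problem on a grid (CPPG), every covering path with coverage radius $k$ is also a covering path with coverage radius $\frac{\lfloor 2k\rfloor}{2}$. That is, if $V_1\subseteq D_{int}$ is the set of stops of a path and every point of $D_{edge}$ is within $\ell_1$ distance $k$ of some point of $V_1$, then every point of $D_{edge}$ is within $\ell_1$ distance $\frac{\lfloor 2k\rfloor}{2}$ of some point of $V_1$.
   Context: Let $m\ge n\ge 1$ be integers, $D=\{(x,y)\in\mathbb{R}^2: 0\le x\le n,\ 0\le y\le m\}$, $D_{int}=D\cap\mathbb{Z}^2$ (the nodes of the unit grid) and $D_{edge}=\{(x,y)\in D: x\in\mathbb{Z}\text{ or }y\in\mathbb{Z}\}$ (the points on the edges of the unit grid). Distances are $\ell_1$ distances. In the CPPG the stops are chosen from $D_{int}$, and a covering path with coverage radius $k$ is a path in the grid connecting a set of stops $V_1\subseteq D_{int}$ such that every point of $D_{edge}$ is at $\ell_1$ distance at most $k$ from some stop in $V_1$. *)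

(* Defs.v *)
From HB Require Import structures.
From mathcomp Require Import all_boot all_order all_algebra.
From mathcomp Require Import classical_sets reals.

Set Implicit Arguments.
Unset Strict Implicit.
Unset Printing Implicit Defensive.

Import Order.TTheory GRing.Theory Num.Theory.
Local Open Scope classical_set_scope.
Local Open Scope ring_scope.

Section CoveringPath.
Variable R : realType.
Implicit Types (m n : nat) (k : R) (p q : R * R).

Definition l1dist p q : R := `|p.1 - q.1| + `|p.2 - q.2|.

(* The first coordinate is bounded by n and the second one by m. *)
Definition D m n : set (R * R) :=
  [set p | 0 <= p.1 <= n%:R /\ 0 <= p.2 <= m%:R].

Definition D_int m n : set (R * R) :=
  [set p | [/\ D m n p, p.1 \is a Num.int & p.2 \is a Num.int]].

Definition D_edge m n : set (R * R) :=
  [set p | D m n p /\ (p.1 \is a Num.int \/ p.2 \is a Num.int)].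

(* A path is given by the sequence of nodes it visits, any two consecutive
   ones being the endpoints of an edge of the unit grid; a node may be visited
   several times, so that simple paths are a special case. *)
Definition grid_path m n (P : seq (R * R)) : Prop :=
  [set` P] `<=` D_int m n /\ sorted (fun p q => l1dist p q == 1) P.

Definition covers m n k (V1 : set (R * R)) : Prop :=
  forall p, D_edge m n p -> exists2 v, V1 v & l1dist p v <= k.

(* The path may also traverse nodes that are not stops. *)
Definition covering_path m n k (P : seq (R * R)) (V1 : set (R * R)) : Prop :=
  [/\ V1 `<=` D_int m n, grid_path m n P, V1 `<=` [set` P]
    & covers m n k V1].

End CoveringPath.

(* Main.v *)
Require Import Defs.
From HB Require Import structures.
From mathcomp Require Import all_boot all_order all_algebra.
From mathcomp Require Import classical_sets reals.
From mathcomp Require Import zify lra.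

Set Implicit Arguments.
Unset Strict Implicit.
Unset Printing Implicit Defensive.

Import Order.TTheory GRing.Theory Num.Theory.
Local Open Scope classical_set_scope.
Local Open Scope ring_scope.

(** Along an edge between adjacent nodes u and w, the distance to a stop v is
    d(u,v) + t or d(w,v) + 1 - t, because the coordinates of v are integers and
    so v never projects inside the edge. At u, w and the midpoint all these
    distances are half-integers, so being at most k there means being at most
    K = floor(2k)/2. Suppose t >= 1/2 and the stop v covering the midpoint is on
    the side of u (the other cases are symmetric or immediate), so that
    d(u,v) + 1/2 <= K. If K is an integer, then even d(u,v) + 1 <= K and v covers
    the whole edge. Otherwise the stop v' covering w satisfies
    d(w,v') <= K - 1/2 and covers the half of the edge next to w. *)

Lemma normB_int_segment (R : realType) (x : R) (i a : int) :
  i%:~R <= x <= (i + 1)%:~R ->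
  `|x - a%:~R| = if a <= i then x - a%:~R else a%:~R - x.
Proof.
case/andP=> ix xi; case: (lerP a i) => ai.
  by rewrite ger0_norm // subr_ge0 (le_trans _ ix) // ler_int.
by rewrite ler0_norm ?opprB // subr_le0 (le_trans xi) // ler_int lezD1.
Qed.

(* A pair in [S] consists of the coordinate of a stop along a grid line and of
   its distance to that line. *)
Lemma cover_line_half_floor (R : realType) (S : set (int * int)) (k x : R) :
  (forall y, (Num.floor x)%:~R <= y <= (Num.ceil x)%:~R ->
    exists2 v, S v & `|y - v.1%:~R| + v.2%:~R <= k) ->
  exists2 v, S v &
    `|x - v.1%:~R| + v.2%:~R <= (Num.floor (2 * k))%:~R / 2.
Proof.
move=> cov; set K := Num.floor (2 * k).
have [xint|xNint] := boolP (x \is a Num.int).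
  (* The segment reduces to the node [x], whose distance to a stop is an integer. *)
  have [|v Sv xv] := cov x; first by rewrite floor_le ceil_ge.
  exists v => //; have /intrP[z xz] := xint.
  have : 2 * (`|z - v.1| + v.2) <= K.
    by rewrite floor_ge_int intrM (intrD _ `|_|) intr_norm intrB -xz; lra.
  by rewrite -(ler_int R) intrM (intrD _ `|_|) intr_norm intrB -xz; lra.
set i := Num.floor x in cov *.
have ceilx : Num.ceil x = i + 1 by rewrite ceil_floor xNint.
rewrite ceilx in cov.
have ix : i%:~R <= x <= (i + 1)%:~R by rewrite floor_le -ceilx ceil_ge.
have i1E : (i + 1)%:~R = i%:~R + 1 :> R by rewrite intrD.
have dist (y : R) (v : int * int) : i%:~R <= y <= i%:~R + 1 ->
    `|y - v.1%:~R| + v.2%:~R =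
    (if v.1 <= i then y - v.1%:~R else v.1%:~R - y) + v.2%:~R.
  by rewrite -i1E => yi; rewrite (normB_int_segment _ yi).
have good v : S v ->
    (if v.1 <= i then x - v.1%:~R else v.1%:~R - x) + v.2%:~R <= K%:~R / 2 ->
    exists2 v, S v & `|x - v.1%:~R| + v.2%:~R <= K%:~R / 2.
  by move=> Sv h; exists v; rewrite // dist //; lra.
have [|u Su] := cov i%:~R; first by lra.
have [|v Sv] := cov (i%:~R + 1 / 2); first by lra.
have [|w Sw] := cov (i%:~R + 1); first by lra.
rewrite !dist; [move=> hw hv hu|lra..].
(* Doubled distances at the two nodes and the midpoint are integers, so the bound [2 * k] rounds
   down to [K], twice the target radius. *)
have {}hu : 2 * ((if u.1 <= i then i - u.1 else u.1 - i) + u.2) <= K.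
  by rewrite floor_ge_int; case: ifP hu => _; lra.
have {}hv : 2 * ((if v.1 <= i then i - v.1 else v.1 - i - 1) + v.2) + 1 <= K.
  by rewrite floor_ge_int; case: ifP hv => _; lra.
have {}hw : 2 * ((if w.1 <= i then i + 1 - w.1 else w.1 - i - 1) + w.2) <= K.
  by rewrite floor_ge_int; case: ifP hw => _; lra.
case: ifP hv (good v Sv) => vi hv goodv; case: (lerP x (i%:~R + 1 / 2)) => xi.
- by apply: goodv; move: hv; rewrite -(ler_int R); lra.
- case: ifP hw (good w Sw) => wi hw goodw.
    by apply: goodw; move: hw; rewrite -(ler_int R); lra.
  (* For even [K], the odd left side of [hv] leaves a spare unit and [v] reaches the far node; for
     odd [K], the even left side of [hw] does and [w] reaches the midpoint. *)
  have [h|h] : 2 * (i + 1 - v.1 + v.2) <= K \/ 2 * (w.1 - i - 1 + w.2) + 1 <= K.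
  + by lia.
  + by apply: goodv; move: h; rewrite -(ler_int R); lra.
  + by apply: goodw; move: h; rewrite -(ler_int R); lra.
- case: ifP hu (good u Su) => ui hu goodu; last first.
    by apply: goodu; move: hu; rewrite -(ler_int R); lra.
  have [h|h] : 2 * (v.1 - i + v.2) <= K \/ 2 * (i - u.1 + u.2) + 1 <= K.
  + by lia.
  + by apply: goodv; move: h; rewrite -(ler_int R); lra.
  + by apply: goodu; move: h; rewrite -(ler_int R); lra.
- by apply: goodv; move: hv; rewrite -(ler_int R); lra.
Qed.

(** The ends 0 and [l] are integers, so rounding never crosses them: the edge around a point of [D]
    stays in [D]. *)
Lemma itv_floor_ceil_sub (R : realType) (z w : R) (l : nat) :
  0 <= z <= l%:R -> (Num.floor z)%:~R <= w <= (Num.ceil z)%:~R ->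
  0 <= w <= l%:R.
Proof.
case/andP=> z0 zl /andP[zw wz]; apply/andP; split.
  by rewrite (le_trans _ zw) // ler0z floor_ge0.
by rewrite (le_trans wz) // pmulrn ler_int ceil_le_int.
Qed.

Theorem proposition1 (R : realType) (m n : nat) (hn : (1 <= n)%N)
    (hmn : (n <= m)%N) (k : R) (hk : 1 <= k)
    (P : seq (R * R)) (V1 : set (R * R)) :
  covering_path m n k P V1 ->
  covering_path m n ((Num.floor (2 * k))%:~R / 2) P V1.
Proof.
case=> V1D gP V1P cov; split=> // -[x y] [[/= Dx Dy] [/intrP[j xj]|/intrP[j yj]]].
(* On a vertical grid line, a stop is recorded by its height and its horizontal distance, an integer
   since [x] is one. *)
- pose S := [set u : int * int | exists2 v, V1 v &
    v.2 = u.1%:~R /\ u.2%:~R = `|x - v.1|].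
  have [z zy|u [v V1v [v2 u2]] yu] := @cover_line_half_floor R S k y.
    have [|v V1v] := cov (x, z).
      by split; [split=> //=; exact: itv_floor_ceil_sub zy | left; rewrite xj intr_int].
    have [_ /intrP[a va] /intrP[b vb]] := V1D v V1v.
    rewrite /l1dist/= => xzv; exists (b, `|j - a|).
      by exists v; rewrite //= intr_norm intrB -xj -va.
    by rewrite /= intr_norm intrB -xj -va -vb addrC.
  by exists v; rewrite // /l1dist/= -u2 v2 addrC.
- pose S := [set u : int * int | exists2 v, V1 v &
    v.1 = u.1%:~R /\ u.2%:~R = `|y - v.2|].
  have [z zx|u [v V1v [v1 u2]] xu] := @cover_line_half_floor R S k x.
    have [|v V1v] := cov (z, y).
      by split; [split=> //=; exact: itv_floor_ceil_sub zx | right; rewrite yj intr_int].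
    have [_ /intrP[a va] /intrP[b vb]] := V1D v V1v.
    rewrite /l1dist/= => zyv; exists (a, `|j - b|).
      by exists v; rewrite //= intr_norm intrB -yj -vb.
    by rewrite /= intr_norm intrB -yj -va -vb.
  by exists v; rewrite // /l1dist/= -u2 v1.
Qed.
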